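(* Let $m \ge 2$ be an integer, let $q$ be a prime power, and let $n \ge 3q^2$ be an integer. Then there exist an $m$-partite graph $G$, having a partition of its vertex set into $m$ independent sets each with at most $3q^2$ vertices, with maximum degree $\Delta(G) \le q + 2m$, and a globally $\left\lceil\frac{n}{q^2+q}\right\rceil$-bounded coloring of $K_{m\otimes n}$ which does not contain a properly colored copy of $G$.
   Context: $K_{m\otimes n}$ denotes the complete $m$-partite graph with exactly $n$ vertices in each of its $m$ classes. A coloring of a graph $H$ is an arbitrary edge-coloring $c: E(H)\to\mathbb{N}$ (not necessarily proper). A coloring $c$ is globally $k$-bounded if every color is used on at most $k$ edges of $H$. A copy of $G$ in $H$ is a subgraph of $H$ isomorphic to $G$ (no particular assignment of the parts of $G$ to the parts of $H$ is prescribed); it is properly colored if any two distinct edges of it sharing a vertex receive distinct colors. *)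

(* Defs.v *)
From HB Require Import structures.
From mathcomp Require Import all_boot all_order all_algebra.

Set Implicit Arguments.
Unset Strict Implicit.
Unset Printing Implicit Defensive.

Record sgraph := SGraph {
  vertex :> finType;
  adj : rel vertex;
  adj_sym : symmetric adj;
  adj_irrefl : irreflexive adj }.

Definition prime_power (q : nat) : Prop :=
  exists p k : nat, [/\ prime p, 0 < k & q = p ^ k].

(* The ceiling of [n / d]; it is nonnegative, so the absolute value only
   serves to read it as a natural number. *)
Definition ceil_div (n d : nat) : nat :=
  `|Num.ceil (n%:R / d%:R : rat)%R|%N.

Definition max_degree (G : sgraph) : nat :=
  \max_(x : G) #|[set y : G | adj x y]|.

Definition independent (G : sgraph) (A : {set G}) : Prop :=
  {in A &, forall x y : G, ~~ adj x y}.

Definition edges (G : sgraph) : {set {set G}} :=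
  [set [set x; y] | x in [set: G], y in [set: G] & adj x y].

(* Blocks of a [partition] are nonempty. *)
Definition multipartition (G : sgraph) (m s : nat) (P : {set {set G}}) : Prop :=
  [/\ partition P [set: G],
      #|P| = m,
      forall A : {set G}, A \in P -> independent A
    & forall A : {set G}, A \in P -> #|A| <= s].

Section CompleteMultipartite.

Variables m n : nat.

Definition Kmn_adj : rel ('I_m * 'I_n)%type := fun x y => x.1 != y.1.

Lemma Kmn_adj_sym : symmetric Kmn_adj.
Proof. by move=> x y; rewrite /Kmn_adj eq_sym. Qed.

Lemma Kmn_adj_irrefl : irreflexive Kmn_adj.
Proof. by move=> x; rewrite /Kmn_adj eqxx. Qed.

(* Vertex [(i, j)] is the [j]-th vertex of the [i]-th class. *)
Definition Kmn : sgraph := SGraph Kmn_adj_sym Kmn_adj_irrefl.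

End CompleteMultipartite.

(* Only the values at members of [edges H] are ever used. *)
Definition coloring (H : sgraph) : Type := {set H} -> nat.

Definition globally_bounded (H : sgraph) (k : nat) (c : coloring H) : Prop :=
  forall a : nat, #|[set e in edges H | c e == a]| <= k.

(* A subgraph is given by its vertex set [U] and its edge set [F]; it need not
   be induced. *)
Definition subgraph (H : sgraph) (U : {set H}) (F : {set {set H}}) : Prop :=
  F \subset edges H /\ forall e : {set H}, e \in F -> e \subset U.

Definition isomorphic_to (G H : sgraph) (U : {set H}) (F : {set {set H}})
    : Prop :=
  exists f : G -> H,
    [/\ injective f,
        f @: [set: G] = U
      & forall x y : G, adj x y = ([set f x; f y] \in F)].

Definition copy (G H : sgraph) (U : {set H}) (F : {set {set H}}) : Prop :=
  subgraph U F /\ isomorphic_to G U F.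

Definition properly_colored (H : sgraph) (c : coloring H) (F : {set {set H}})
    : Prop :=
  {in F &, forall e1 e2 : {set H},
     e1 != e2 -> e1 :&: e2 != set0 -> c e1 <> c e2}.

(* Main.v *)
(* G is the (m-1)-st power of a path on m(q^2+q+1) vertices, together with the
   incidence graph of a projective plane of order q between the vertices at
   positions 0 and those at positions 1 modulo m.  The path power is uniquely
   m-colorable, so any copy of G in the complete multipartite graph sends each
   residue class into a single class, whatever assignment the copy uses.  Cut
   each class into q^2+q parts of size at most ceil(n/(q^2+q)) and color an edge
   by its endpoint in the lower class, its upper class, and the part of its
   upper endpoint.  Of the q^2+q+1 points (or lines) of the plane, whichever
   land in the upper class, two share a part; they have a common neighbor in
   the lower class, and the two edges to it have the same color. *)
Require Import Defs.
From HB Require Import structures.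
From mathcomp Require Import all_boot all_order all_algebra.
From mathcomp Require Import all_field zify ring.

(** * The projective plane over a finite field *)

Section ProjectivePlane.

Import GRing.Theory.
Local Open Scope ring_scope.
Variable F : finFieldType.

(* Points and lines are both represented by the normalized vectors (1, a, b),
   (0, 1, a), (0, 0, 1), incidence being orthogonality, so that the duality of
   the plane becomes the symmetry of one relation. *)
Definition proj_point : finType := option (F + F * F).

Definition proj_coord (p : proj_point) : F * F * F :=
  match p with
  | Some (inr (a, b)) => (1, a, b)
  | Some (inl a) => (0, 1, a)
  | None => (0, 0, 1)
  end.

Definition dot3 (u v : F * F * F) : F :=
  u.1.1 * v.1.1 + u.1.2 * v.1.2 + u.2 * v.2.

Definition orthogonal_points : rel proj_point :=
  fun p r => dot3 (proj_coord p) (proj_coord r) == 0.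

Lemma orthogonal_points_sym : symmetric orthogonal_points.
Proof.
move=> p r; rewrite /orthogonal_points /dot3.
by congr (_ == _); ring.
Qed.

Lemma card_proj_point : #|proj_point| = ((#|F| ^ 2 + #|F|).+1)%N.
Proof. by rewrite card_option card_sum card_prod mulnn addnC. Qed.

Lemma proj_coord_neq0 p : proj_coord p != (0, 0, 0).
Proof.
by case: p => [[a|[a b]]|] /=; rewrite !xpair_eqE oner_eq0 ?andbF.
Qed.

(** Dividing by the first nonzero coordinate normalizes [w], and scaling by a nonzero factor
    preserves orthogonality. *)
Lemma proj_point_of_neq0 (w : F * F * F) : w != (0, 0, 0) ->
  exists p : proj_point, forall u, dot3 u w = 0 -> dot3 u (proj_coord p) = 0.
Proof.
case: w => [[w0 w1] w2] w_neq0.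
suff [p [k k0 E]] : exists p, exists2 k, k != 0 &
    (w0, w1, w2) = (k * (proj_coord p).1.1, k * (proj_coord p).1.2,
                    k * (proj_coord p).2).
  exists p => u; rewrite E /dot3 /= => H; apply: (mulfI k0).
  by rewrite mulr0 -H; ring.
have [w00|w00] := eqVneq w0 0; last first.
  exists (Some (inr (w1 / w0, w2 / w0))), w0 => //=.
  by rewrite mulr1 !(mulrC w0) !mulfVK.
have [w10|w10] := eqVneq w1 0; last first.
  exists (Some (inl (w2 / w1))), w1 => //=.
  by rewrite w00 mulr0 mulr1 !(mulrC w1) !mulfVK.
exists None, w2; last by rewrite /= w00 w10 !mulr0 mulr1.
by apply: contra w_neq0 => /eqP->; rewrite w00 w10.
Qed.

Definition cross3 (u v : F * F * F) : F * F * F :=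
  (u.1.2 * v.2 - u.2 * v.1.2, u.2 * v.1.1 - u.1.1 * v.2,
   u.1.1 * v.1.2 - u.1.2 * v.1.1).

(** A vanishing cross product means proportional vectors, and proportional normalized vectors
    coincide. *)
Lemma cross3_proj_coord p r :
  cross3 (proj_coord p) (proj_coord r) = (0, 0, 0) -> p = r.
Proof.
case: p => [[a|[a b]]|]; case: r => [[c|[c d]]|] //=;
  rewrite /cross3 /= !(mul0r, mulr0, mul1r, mulr1, subr0, sub0r) => -[] //.
- by move=> /subr0_eq ->.
- by move=> _ _ /eqP; rewrite oppr_eq0 oner_eq0.
- by move=> /eqP; rewrite oner_eq0.
- by move=> _ _ /eqP; rewrite oner_eq0.
- by move=> _ /subr0_eq -> /subr0_eq ->.
- by move=> _ /eqP; rewrite oppr_eq0 oner_eq0.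
- by move=> /eqP; rewrite oppr_eq0 oner_eq0.
- by move=> _ /eqP; rewrite oner_eq0.
Qed.

(** The cross product of the two vectors, once normalized, is orthogonal to both. *)
Lemma common_orthogonal_point p r : p != r ->
  exists s, orthogonal_points p s /\ orthogonal_points r s.
Proof.
move=> pr; have [|s Hs] :=
  @proj_point_of_neq0 (cross3 (proj_coord p) (proj_coord r)).
  by apply: contra pr => /eqP /cross3_proj_coord ->.
by exists s; split; apply/eqP/Hs; rewrite /dot3 /cross3 /=; ring.
Qed.

Lemma card_orthogonal_points p :
  (#|[set r | orthogonal_points p r]| <= #|F|.+1)%N.
Proof.
rewrite -card_option.
(* If [p] has last coordinate 0, its line contains (0, 0, 1), and the other points differ in their
   third coordinate. Otherwise the points (1, a, b) of the line are told apart by [a], and a single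
   point starting with 0 remains for [None]. *)
pose key (r : proj_point) : option F :=
  if (proj_coord p).2 == 0 then
    if r is Some _ then Some (proj_coord r).2 else None
  else if r is Some (inr _) then Some (proj_coord r).1.2 else None.
have key_inj : {in [set r | orthogonal_points p r] &, injective key}.
  move=> r s; rewrite !inE /orthogonal_points /dot3 /key.
  have := proj_coord_neq0 p.
  move: (proj_coord p) => [[u0 u1] u2] /=.
  have [->|u2n0] := eqVneq u2 0.
    have [->|u1n0] := eqVneq u1 0.
      rewrite !xpair_eqE !eqxx !andbT => u0n0.
      case: r => [[a|[a b]]|]; case: s => [[c|[c d]]|] //=;
      by rewrite ?(mul0r, mulr0, mulr1, addr0) ?(negPf u0n0) // => _ _ [->].
    move=> _.
    case: r => [[a|[a b]]|]; case: s => [[c|[c d]]|] //=;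
      rewrite ?(mul0r, mulr0, mulr1, addr0, add0r) ?(negPf u1n0) //.
    by move=> /eqP <- /eqP /addrI /(mulfI u1n0) -> [->].
  move=> _; case: r => [[a|[a b]]|]; case: s => [[c|[c d]]|] //=;
      rewrite ?(mul0r, mulr0, mulr1, addr0, add0r) ?(negPf u2n0) //.
  - by move=> /eqP <- /eqP /addrI /(mulfI u2n0) ->.
  - by move=> /eqP <- /eqP /[swap] -[->] /addrI /(mulfI u2n0) ->.
by rewrite -(card_in_imset key_inj) max_card.
Qed.

End ProjectivePlane.

(** * The coloring by stars *)

Import Order.POrderTheory Num.Theory.

Lemma ceil_div_mul_ge (n d : nat) : 0 < d -> n <= ceil_div n d * d.
Proof.
move=> d_gt0; rewrite /ceil_div.
set x : rat := (n%:R / d%:R)%R.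
have x_ge0 : (0 <= x)%R by rewrite divr_ge0 ?ler0n.
have x_le : (x <= (Num.ceil x)%:~R)%R by rewrite -ceil_le_int.
have : (x <= `|Num.ceil x|%N%:R)%R.
  by rewrite natr_absz ger0_norm // -(ler0z rat) (le_trans x_ge0).
by rewrite ler_pdivrMr ?ltr0n // -GRing.natrM ler_nat.
Qed.

(** Within one residue class an element is determined by its quotient by [d]. *)
Lemma card_residue_class (n d r : nat) : 0 < d ->
  #|[set w : 'I_n | w %% d == r]| <= ceil_div n d.
Proof.
move=> d_gt0; have Hn := ceil_div_mul_ge n d d_gt0.
have quo_lt (w : 'I_n) : w %/ d < ceil_div n d.
  by rewrite ltn_divLR // (leq_trans (ltn_ord w)).
rewrite -[leqRHS]card_ord.
rewrite -(card_in_imset (f := fun w => Ordinal (quo_lt w))) ?max_card //.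
move=> v w; rewrite !inE => /eqP Ev /eqP Ew /(congr1 val) /= E.
by apply: val_inj; rewrite /= (divn_eq v d) (divn_eq w d) E Ev Ew.
Qed.

Section StarColoring.

Variables m n d : nat.
Hypothesis d_gt0 : 0 < d.
Local Notation K := (Kmn m n).

Definition star_color (x y : K) : nat := pickle (x, y.1, y.2 %% d).

(** An edge is an unordered pair; [pick] recovers its endpoints in the order of their classes. The
    default 0 is reached only off the edges. *)
Definition residue_coloring : coloring K := fun e =>
  if [pick p : K * K | (e == [set p.1; p.2]) && (p.1.1 < p.2.1)] is Some p
  then star_color p.1 p.2 else 0.

Lemma residue_coloringE (x y : K) : x.1 < y.1 ->
  residue_coloring [set x; y] = star_color x y.
Proof.
move=> xy; rewrite /residue_coloring.
case: pickP => [[a b] /=|/(_ (x, y))]; last first.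
  by rewrite /= eqxx xy.
move=> /andP[/eqP E ab].
have := set21 x y; have := set22 x y; rewrite E !inE; move: xy.
move=> /[swap] /orP[] /eqP-> /[swap] /orP[] /eqP-> //; rewrite ?ltnn //.
by rewrite ltnNge (ltnW ab).
Qed.

Lemma edges_Kmn (e : {set K}) : e \in edges K ->
  exists x y : K, x.1 < y.1 /\ e = [set x; y].
Proof.
case/imset2P => x y _; rewrite !inE /= /Kmn_adj => xy ->.
have [lt|gt|eq] := ltngtP x.1 y.1; first by exists x, y.
  by exists y, x; rewrite setUC.
by rewrite (val_inj eq) eqxx in xy.
Qed.

(** A color fixes the lower endpoint and the class and residue of the upper one, so its edges form a
    star with leaves in one residue class. *)
Lemma residue_coloring_bounded :
  globally_bounded (ceil_div n d) residue_coloring.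
Proof.
move=> a; set S := [set e in _ | _].
have [->|[e0]] := set_0Vmem S; first by rewrite cards0.
rewrite inE => /andP[/edges_Kmn[x0 [y0 [xy0 ->]]]].
rewrite residue_coloringE // => /eqP Ea.
apply: leq_trans (card_residue_class n d (y0.2 %% d) d_gt0).
apply: leq_trans (leq_imset_card (fun w => [set x0; (y0.1, w) : K]) _).
apply: subset_leq_card; apply/subsetP => e.
rewrite inE => /andP[/edges_Kmn[x [[j w] [xy ->]]]].
rewrite residue_coloringE // -Ea => /eqP /(pcan_inj pickleK) [-> /= -> E].
by apply/imsetP; exists w; rewrite ?inE ?E.
Qed.

End StarColoring.

(** * The uniquely colorable graph *)

Section RigidGraph.

Variables (T : finType) (inc : rel T) (m : nat).
Hypotheses (inc_sym : symmetric inc) (m_ge2 : 2 <= m).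

(** The path runs through blocks of [m] vertices, so [x.2] is the position modulo [m]. *)
Definition path_pos (x : T * 'I_m) : nat := enum_rank x.1 * m + x.2.

Lemma path_pos_inj : injective path_pos.
Proof.
move=> [t i] [u j]; rewrite /path_pos /= => E.
have Eij : i = j.
  by have := congr1 (modn^~ m) E; rewrite !modnMDl !modn_small // => /val_inj.
move: E; rewrite Eij => /eqP; rewrite eqn_add2r eqn_pmul2r; last by lia.
by move=> /eqP /val_inj /enum_rank_inj ->.
Qed.

Lemma path_pos_surj p : p < #|T| * m -> exists x, path_pos x = p.
Proof.
move=> p_lt; have m_gt0 : 0 < m by lia.
have q_lt : p %/ m < #|T| by rewrite ltn_divLR.
exists (enum_val (Ordinal q_lt), Ordinal (ltn_pmod p m_gt0)).
by rewrite /path_pos /= enum_valK -divn_eq.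
Qed.

Lemma path_pos_lt x : path_pos x < #|T| * m.
Proof.
rewrite /path_pos (@leq_trans ((enum_rank x.1).+1 * m)) //.
  by rewrite mulSn addnC ltn_add2r.
by rewrite leq_mul2r ltn_ord orbT.
Qed.

Definition near : rel (T * 'I_m) := fun x y =>
  [&& x != y, path_pos x < path_pos y + m & path_pos y < path_pos x + m].

(** The sum is 1 exactly when the classes are 0 and 1 in some order. *)
Definition linked : rel (T * 'I_m) := fun x y =>
  (x.2 + y.2 == 1) && inc x.1 y.1.

Definition rigid_adj : rel (T * 'I_m) := fun x y => near x y || linked x y.

Lemma rigid_adj_sym : symmetric rigid_adj.
Proof.
move=> x y; rewrite /rigid_adj /near /linked (addnC x.2) inc_sym (eq_sym x).
by rewrite (andbC (_ < _)).
Qed.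

Lemma rigid_adj_irrefl : irreflexive rigid_adj.
Proof.
by move=> x; rewrite /rigid_adj /near /linked eqxx /= addnn;
  case: eqP => //; lia.
Qed.

Definition rigid_graph : sgraph := SGraph rigid_adj_sym rigid_adj_irrefl.

(** The bound counts all offsets strictly between [-m] and [m], including that of [x] itself. *)
Lemma card_near x : #|[set y | near x y]| <= m.*2.-1.
Proof.
have off_lt (y : T * 'I_m) : near x y ->
    path_pos y + m - (path_pos x).+1 < m.*2.-1.
  by case/and3P; lia.
pose off (y : T * 'I_m) : 'I_(m.*2.-1).-1.+1 :=
  inord (path_pos y + m - (path_pos x).+1).
rewrite -[leqRHS]card_ord -[in leqRHS](prednK (n := m.*2.-1)); last by lia.
rewrite -(card_in_imset (f := off)) ?max_card // => y z; rewrite !inE => xy xz.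
move=> /(congr1 val); rewrite /= !inordK ?prednK; try by [lia|exact: off_lt].
case/and3P: xy => _ xy _; case/and3P: xz => _ xz _ E.
by apply: path_pos_inj; lia.
Qed.

(** The class of a vertex linked to [x] must be [1 - x.2], so its first component determines it. *)
Lemma card_linked x : #|[set y | linked x y]| <= #|[set t | inc x.1 t]|.
Proof.
have fst_inj : {in [set y | linked x y] &, injective (@fst T 'I_m)}.
  move=> [t i] [u j]; rewrite !inE /linked /=.
  move=> /andP[/eqP xi _] /andP[/eqP xj _] ->.
  by congr (_, _); apply: ord_inj; lia.
rewrite -(card_in_imset fst_inj); apply: subset_leq_card.
by apply/subsetP => _ /imsetP[y + ->]; rewrite !inE => /andP[].
Qed.

Lemma max_degree_rigid_graph q : (forall t, #|[set u | inc t u]| <= q) ->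
  max_degree rigid_graph <= m.*2.-1 + q.
Proof.
move=> degT; apply/bigmax_leqP => x _.
have -> : [set y : rigid_graph | adj x y] =
    [set y | near x y] :|: [set y | linked x y].
  by apply/setP => y; rewrite !inE.
apply: leq_trans (leq_card_setU _ _) _.
by apply: leq_add (card_near x) (leq_trans (card_linked x) (degT _)).
Qed.

Definition rigid_class (i : 'I_m) : {set rigid_graph} := [set x | x.2 == i].

(** Positions in one class differ by multiples of [m]. *)
Lemma near_class_neq x y : near x y -> x.2 != y.2.
Proof.
case/and3P => xy lt1 lt2; apply: contra xy => /eqP E.
have mul_lt a b : a < b -> a * m + m <= b * m.
  by move=> ab; rewrite -mulSnr leq_mul2r ab orbT.
move: lt1 lt2; rewrite /path_pos E !(addnAC _ _ m) !ltn_add2r => lt1 lt2.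
suff /val_inj/enum_rank_inj E1 : enum_rank x.1 = enum_rank y.1 :> nat.
  by case: x y E E1 {lt1 lt2} => [t i] [u j] /= -> ->.
by apply/eqP; case: ltngtP => // /mul_lt; rewrite leqNgt ?lt1 ?lt2.
Qed.

Lemma rigid_class_independent i : independent (rigid_class i).
Proof.
move=> x y; rewrite !inE => /eqP xi /eqP yi; apply/norP; split.
  by apply/negP => /near_class_neq; rewrite xi yi eqxx.
by rewrite /linked xi yi addnn; case: eqP => //; lia.
Qed.

Lemma card_rigid_class i : #|rigid_class i| = #|T|.
Proof.
have -> : rigid_class i = [set (t, i) | t in [set: T]].
  apply/setP => -[t j]; rewrite !inE /=.
  apply/eqP/imsetP => [->|[u _ [_ ->]] //].
  by exists t.
by rewrite card_imset ?cardsT // => t u [].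
Qed.

Lemma rigid_multipartition s : 0 < #|T| <= s ->
  multipartition m s [set rigid_class i | i in [set: 'I_m]].
Proof.
case/andP => /card_gt0P[t0 _] T_le.
have class_inj : injective rigid_class.
  by move=> i j /setP /(_ (t0, i)); rewrite !inE eqxx => /esym /eqP.
split; [|by rewrite card_imset // cardsT card_ord| |].
- apply/and3P; split.
  + apply/eqP/setP => x; rewrite inE; apply/bigcupP.
    by exists (rigid_class x.2); rewrite ?imset_f ?inE.
  + apply/trivIsetP => _ _ /imsetP[i _ ->] /imsetP[j _ ->] ij.
    apply/pred0P => x; rewrite !inE /=; apply/negbTE; apply: contra ij.
    by case/andP => /eqP<- /eqP<-.
  + apply/negP => /imsetP[i _ /setP /(_ (t0, i))].
    by rewrite !inE eqxx.
- by move=> _ /imsetP[i _ ->]; exact: rigid_class_independent.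
- by move=> _ /imsetP[i _ ->]; rewrite card_rigid_class.
Qed.

(** * Unique colorability with [m] colors *)

Variable col : T * 'I_m -> 'I_m.
Hypothesis col_proper : forall x y, rigid_adj x y -> col x != col y.

Lemma col_near x y : path_pos x < path_pos y < path_pos x + m -> col x != col y.
Proof.
move=> /andP[xy yx]; apply: col_proper; apply/orP; left.
apply/and3P; split; try lia.
by apply: contraTneq xy => ->; rewrite ltnn.
Qed.

(* The [m] consecutive positions starting at [x] use all [m] colors, and those
   strictly between [x] and [y] are adjacent to [y]. *)
Lemma col_shift x y : path_pos y = path_pos x + m -> col y = col x.
Proof.
move=> xy.
have P (s : 'I_m) : exists z, path_pos z == path_pos x + s.
  have [|z zE] := path_pos_surj (path_pos x + s); last by exists z; apply/eqP.
  by have := path_pos_lt y; have := ltn_ord s; lia.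
pose z s := xchoose (P s).
have zE s : path_pos (z s) = path_pos x + s by apply/eqP/(xchooseP (P s)).
have z_inj : injective (col \o z).
  move=> s s' /= E; apply: ord_inj; apply/eqP; case: ltngtP => // lt.
    have /eqP := E; apply: contraTT => _; apply: col_near.
    by rewrite !zE; have := ltn_ord s'; lia.
  have /esym /eqP := E; apply: contraTT => _; apply: col_near.
  by rewrite !zE; have := ltn_ord s; lia.
have [g _ gK] := injF_bij z_inj.
have /= E := gK (col y).
have [s0|s_gt0] := posnP (g (col y)).
  by rewrite -E; congr col; apply: path_pos_inj; rewrite zE s0 addn0.
suff : col (z (g (col y))) != col y by rewrite E eqxx.
by apply: col_near; rewrite zE xy; have := ltn_ord (g (col y)); lia.
Qed.

(** By induction on the block, [col_shift] carries the color of block 0 along the class. *)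
Lemma col_class x y : x.2 = y.2 -> col x = col y.
Proof.
case: x y => [t i] [u j] /= <-.
have m_gt0 : 0 < m by lia.
have T_gt0 : 0 < #|T| by apply/card_gt0P; exists t.
pose t0 := enum_val (Ordinal T_gt0).
suff H k t' : enum_rank t' = k :> nat -> col (t', i) = col (t0, i).
  by rewrite !(H _ _ erefl).
elim: k t' => [|k IH] t' Ek.
  congr (col (_, _)); rewrite -(enum_rankK t'); congr enum_val.
  exact: val_inj.
have k_lt : k < #|T| by rewrite ltnW -?Ek ?ltn_ord.
rewrite -(IH (enum_val (Ordinal k_lt))) ?enum_valK //.
by apply: col_shift; rewrite /path_pos /= enum_valK Ek mulSnr addnAC.
Qed.

End RigidGraph.

(** * Excluding properly colored copies *)

Lemma residue_collision (n d : nat) (T : finType) (g : T -> 'I_n) :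
  0 < d < #|T| -> exists t u, t != u /\ g t = g u %[mod d].
Proof.
case/andP => d_gt0 d_lt; pose h t : 'I_d := Ordinal (ltn_pmod (g t) d_gt0).
have /injectivePn[t [u tu E]] : ~~ injectiveb h.
  apply: contraL d_lt => /injectiveP h_inj.
  by rewrite -leqNgt -[leqRHS]card_ord -(card_imset _ h_inj) max_card.
by exists t, u; split=> //; have [] := congr1 val E.
Qed.

Theorem proposition1p6 (m q n : nat) (hm : 2 <= m) (hq : prime_power q)
    (hn : 3 * q ^ 2 <= n) :
  exists G : sgraph,
    [/\ exists P : {set {set G}}, multipartition m (3 * q ^ 2) P,
        max_degree G <= q + 2 * m
      & exists c : coloring (Kmn m n),
          globally_bounded (ceil_div n (q ^ 2 + q)) c /\
          ~ (exists (U : {set Kmn m n}) (F : {set {set Kmn m n}}),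
               copy G U F /\ properly_colored c F)].
Proof.
case: hq => p [k [p_prime k_gt0 q_eq]].
have q_ge2 : 2 <= q.
  by rewrite q_eq -(prednK k_gt0) expnS (leq_trans (prime_gt1 p_prime)) //
    leq_pmulr ?expn_gt0 ?prime_gt0.
have d_gt0 : 0 < q ^ 2 + q by lia.
have [F _ F_card] := PrimePowerField p_prime k_gt0.
rewrite -q_eq in F_card.
pose T := proj_point F; pose inc := @orthogonal_points F.
have T_card : #|{: T}| = (q ^ 2 + q).+1 by rewrite card_proj_point F_card.
have d_range : 0 < q ^ 2 + q < #|T| by rewrite T_card ltnSn andbT.
have inc_sym : symmetric inc by exact: orthogonal_points_sym.
exists (rigid_graph T inc m inc_sym hm); split.
- eexists; apply: rigid_multipartition.
  by rewrite T_card -mulnn; nia.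
(* The path power contributes 2m - 1 and the plane q + 1. *)
- apply: leq_trans (@max_degree_rigid_graph _ _ _ _ _ q.+1 _) _; last by lia.
  by move=> t; rewrite -F_card; exact: card_orthogonal_points.
exists (residue_coloring m n (q ^ 2 + q)); split.
  exact: residue_coloring_bounded.
case=> U [E [[[/subsetP E_edges _] [f [f_inj _ f_adj]]] proper]].
(* The classes receiving the images give a proper coloring of [G] with [m] colors. *)
have f_proper x y : rigid_adj T inc m x y -> (f x).1 != (f y).1.
  rewrite [rigid_adj _ _ _ _ _]f_adj => /E_edges /edges_Kmn[a [b [ab fxy]]].
  apply: contraTneq ab => fE.
  have := set21 a b; have := set22 a b; rewrite -fxy !inE.
  by move=> /orP[] /eqP-> /orP[] /eqP->; rewrite ?fE ltnn.
have f_class x y : x.2 = y.2 -> (f x).1 = (f y).1.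
  exact: (col_class T inc m hm (fun x => (f x).1) f_proper).
(* [i] and [j] are the residues [0] and [1] modulo [m], in the order of the
   classes of [Kmn m n] to which the copy sends them. *)
have key (i j : 'I_m) (t0 : T) : i + j = 1 ->
    (f (t0, i)).1 < (f (t0, j)).1 -> False.
  move=> ij lt.
  (* Pigeonhole: q^2 + q + 1 elements of [T] against q^2 + q residues. *)
  have [t [u [tu tuE]]] :=
    residue_collision n (q ^ 2 + q) T (fun t => (f (t, j)).2) d_range.
  have [s [ts us]] := common_orthogonal_point _ t u tu.
  have in_E v : inc v s -> [set f (s, i); f (v, j)] \in E.
    by move=> vs; rewrite -f_adj; apply/orP; right;
      rewrite /linked /= ij inc_sym.
  have col_E v : residue_coloring m n (q ^ 2 + q) [set f (s, i); f (v, j)]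
      = star_color m n (q ^ 2 + q) (f (s, i)) (f (v, j)).
    by apply: residue_coloringE;
      rewrite (f_class (s, i) (t0, i)) // (f_class (v, j) (t0, j)).
  apply: (proper _ _ (in_E t ts) (in_E u us)).
  (* If the edges coincided, injectivity of [f] would give [t = u], or [i = j] against the parity of
     [i + j = 1]. *)
  - apply: contra tu => /eqP st; have := set22 (f (s, i)) (f (t, j)).
    rewrite st !inE => /orP[] /eqP /f_inj; last by case=> ->.
    by case=> _ ji; move: ij; rewrite ji addnn; lia.
  - by apply/set0Pn; exists (f (s, i)); rewrite !inE eqxx.
  - by rewrite !col_E /star_color tuE (f_class (t, j) (u, j)).
have m_gt0 : 0 < m by lia.
pose i := Ordinal m_gt0; pose j := Ordinal hm; pose t0 : T := None.
(* Any incident pair gives an edge between residues 0 and 1; the second point [Some (inl 0)] is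
   there only to produce [s] incident to [t0]. *)
have : (f (t0, i)).1 != (f (t0, j)).1.
  have [|s [s0 _]] := common_orthogonal_point _ t0 (Some (inl 0%R)) => //.
  rewrite (f_class (t0, j) (s, j)) //; apply: f_proper.
  by apply/orP; right; apply/andP.
rewrite -val_eqE; case: ltngtP => // lt _; [exact: key lt|exact: key lt].
Qed.
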